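(* Let $m=2+12q$ with $q=2+2d$ for a nonnegative integer $d$, and let $u=u_1(q)$. The minimal decomposition of $\mathbb{Z}_2$ for the Fibonacci polynomial $F_m$ is $$\mathbb{Z}_2=\{0\}\sqcup\Bigl(\bigl(\bigcup_{k=0}^{2^{u+2}-1}A_k\bigr)\cup\bigl(\bigcup_{n\ge 1}\bigcup_{k=0}^{2^{u}-1}M_{n,k}\bigr)\Bigr),$$ where $A_k=1+2k+2^{u+3}\mathbb{Z}_2$ and $M_{n,k}=(1+2k)2^n+2^{n+u+1}\mathbb{Z}_2$. Here $\{0\}$ is the set of a fixed point, and the $A_k$'s and $M_{n,k}$'s are the minimal components.
   Context: $\mathbb{Z}_2$ is the ring of 2-adic integers with the 2-adic metric. The Fibonacci polynomials are defined by $F_0(x)=0$, $F_1(x)=1$, $F_m(x)=xF_{m-1}(x)+F_{m-2}(x)$ for $m\ge 2$. For a nonnegative integer $q$ with binary expansion $q=\sum_i c_i2^i$, $c_i\in\{0,1\}$, define $u_1(q)=\min\{i\ge 1: c_i=1\}$. For a polynomial $f$ over $\mathbb{Z}_2$, a minimal decomposition of $\mathbb{Z}_2$ for $f$ is a decomposition $\mathbb{Z}_2=\mathcal P\sqcup\mathcal M\sqcup\mathcal B$ (some parts possibly empty) in which: $\mathcal P$ is the finite set consisting of all periodic points of $f$; $\mathcal M=\bigsqcup_i\mathcal M_i$ is the union of all (at most countably many) clopen $f$-invariant sets $\mathcal M_i$ (the minimal components), each a finite union of balls, such that each $f:\mathcal M_i\to\mathcal M_i$ is minimal (every orbit is dense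 in $\mathcal M_i$); and each point of $\mathcal B$ lies in the attracting basin of a periodic orbit or of a minimal subsystem. *)

(* Defs.v *)
From HB Require Import structures.
From mathcomp Require Import all_boot all_order all_algebra.
From mathcomp Require Import boolp classical_sets cardinality functions.
From mathcomp Require Import topology.

Set Implicit Arguments.
Unset Strict Implicit.
Unset Printing Implicit Defensive.

Import Order.TTheory GRing.Theory Num.Theory.

Local Open Scope ring_scope.
Local Open Scope classical_set_scope.

(* Inverse limit of the rings Z/2^n: [res2 x n] is the canonical representative
   in [0, 2^n) of the class of [x] modulo 2^n.  The single equation
   [res2_compat] yields both the bound and the compatibility. *)
Record Z2 : Type := MkZ2 {
  res2 :> nat -> nat;
  res2_compat : forall n, (res2 n.+1 %% 2 ^ n)%N = res2 n
}.

Lemma Z2_eq (x y : Z2) : (forall n, x n = y n) -> x = y.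
Proof.
case: x y => [x hx] [y hy] /= /funext xy; subst y.
by rewrite (Prop_irrelevance hx hy).
Qed.

HB.instance Definition _ := gen_eqMixin Z2.
HB.instance Definition _ := gen_choiceMixin Z2.

Lemma res2_lt (x : Z2) n : (x n < 2 ^ n)%N.
Proof. by rewrite -res2_compat ltn_pmod// expn_gt0. Qed.

Lemma res2_modn (x : Z2) n : (x n %% 2 ^ n)%N = x n.
Proof. by rewrite modn_small// res2_lt. Qed.

Lemma modn_expS (a n : nat) : (a %% 2 ^ n.+1 = a %[mod 2 ^ n])%N.
Proof. by rewrite modn_dvdm// dvdn_exp2l. Qed.

Fact Z2_nat_subproof (k n : nat) : ((k %% 2 ^ n.+1) %% 2 ^ n = k %% 2 ^ n)%N.
Proof. exact: modn_expS. Qed.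
Definition Z2_nat k := MkZ2 (Z2_nat_subproof k).

Fact Z2_add_subproof (x y : Z2) (n : nat) :
  (((x n.+1 + y n.+1) %% 2 ^ n.+1) %% 2 ^ n = (x n + y n) %% 2 ^ n)%N.
Proof. by rewrite modn_expS -modnDm !res2_compat. Qed.
Definition Z2_add x y := MkZ2 (Z2_add_subproof x y).

Fact Z2_mul_subproof (x y : Z2) (n : nat) :
  (((x n.+1 * y n.+1) %% 2 ^ n.+1) %% 2 ^ n = (x n * y n) %% 2 ^ n)%N.
Proof. by rewrite modn_expS -modnMm !res2_compat. Qed.
Definition Z2_mul x y := MkZ2 (Z2_mul_subproof x y).

Fact Z2_opp_subproof (x : Z2) (n : nat) :
  (((2 ^ n.+1 - x n.+1) %% 2 ^ n.+1) %% 2 ^ n = (2 ^ n - x n) %% 2 ^ n)%N.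
Proof.
rewrite modn_expS; apply/eqP.
rewrite -(eqn_modDr (x n.+1)) subnK; last exact/ltnW/res2_lt.
rewrite -[X in _ == X]modnDmr res2_compat subnK; last exact/ltnW/res2_lt.
by rewrite expnS modnMl modnn.
Qed.
Definition Z2_opp x := MkZ2 (Z2_opp_subproof x).

Fact Z2_addA : associative Z2_add.
Proof. by move=> x y z; apply: Z2_eq => n /=; rewrite modnDmr modnDml addnA. Qed.

Fact Z2_addC : commutative Z2_add.
Proof. by move=> x y; apply: Z2_eq => n /=; rewrite addnC. Qed.

Fact Z2_add0 : left_id (Z2_nat 0) Z2_add.
Proof. by move=> x; apply: Z2_eq => n /=; rewrite mod0n add0n res2_modn. Qed.

Fact Z2_addN : left_inverse (Z2_nat 0) Z2_opp Z2_add.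
Proof.
move=> x; apply: Z2_eq => n /=.
by rewrite modnDml subnK ?modnn ?mod0n//; exact/ltnW/res2_lt.
Qed.

HB.instance Definition _ :=
  GRing.isZmodule.Build Z2 Z2_addA Z2_addC Z2_add0 Z2_addN.

Fact Z2_mulA : associative Z2_mul.
Proof. by move=> x y z; apply: Z2_eq => n /=; rewrite modnMmr modnMml mulnA. Qed.

Fact Z2_mulC : commutative Z2_mul.
Proof. by move=> x y; apply: Z2_eq => n /=; rewrite mulnC. Qed.

Fact Z2_mul1 : left_id (Z2_nat 1) Z2_mul.
Proof. by move=> x; apply: Z2_eq => n /=; rewrite modnMml mul1n res2_modn. Qed.

Fact Z2_mulDl : left_distributive Z2_mul Z2_add.
Proof. by move=> x y z; apply: Z2_eq => n /=; rewrite modnMml modnDm mulnDl. Qed.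

Fact Z2_1neq0 : Z2_nat 1 != 0 :> Z2.
Proof. by apply/eqP => /(congr1 (fun x : Z2 => x 1%N)). Qed.

HB.instance Definition _ := GRing.Zmodule_isComNzRing.Build Z2
  Z2_mulA Z2_mulC Z2_mul1 Z2_mulDl Z2_1neq0.

Lemma res2_0 n : (0 : Z2) n = 0%N.
Proof. by rewrite /= mod0n. Qed.

Lemma res2D (x y : Z2) n : (x + y) n = ((x n + y n) %% 2 ^ n)%N.
Proof. by []. Qed.

Lemma res2M (x y : Z2) n : (x * y) n = ((x n * y n) %% 2 ^ n)%N.
Proof. by []. Qed.

Lemma res2_natr k n : (k%:R : Z2) n = (k %% 2 ^ n)%N.
Proof.
elim: k => [|k IH]; first by rewrite mulr0n res2_0 mod0n.
by rewrite -natr1 res2D IH /= modnDm addn1.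
Qed.

Lemma res2_subr_eq0 (x y : Z2) n : ((x - y) n == 0%N) = (x n == y n).
Proof.
apply/eqP/eqP => [xy0|xy].
  have := res2D (x - y) y n.
  by rewrite subrK xy0 add0n res2_modn.
rewrite /= xy modnDmr addnC subnK ?modnn//; exact/ltnW/res2_lt.
Qed.

(* The 2-adic metric takes values in the rationals, so [rat] serves as its
   codomain. *)

Definition nonzero_res (x : Z2) := exists n, x n.+1 != 0%N.

Lemma nonzero_resPn (x : Z2) : ~ nonzero_res x -> x = 0.
Proof.
move=> h; apply: Z2_eq => -[|n]; rewrite res2_0.
  by have := res2_lt x 0; rewrite expn0 ltnS leqn0 => /eqP.
by apply/eqP/negPn/negP => ?; apply: h; exists n.
Qed.

(* For x != 0 the exponent is the 2-adic valuation of x: the least n such that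
   2^(n+1) does not divide x. *)
Definition Z2_norm (x : Z2) : rat :=
  if pselect (nonzero_res x) is left h then (2 ^+ ex_minn h)^-1 else 0.

Definition Z2_dist (x y : Z2) : rat := Z2_norm (x - y).

Lemma res2_eq0_le (x : Z2) m n : (m <= n)%N -> x n = 0%N -> x m = 0%N.
Proof.
move=> /subnK <-; elim: (n - m)%N => [//|k IH] h; apply: IH.
by rewrite addSn in h; rewrite -res2_compat h mod0n.
Qed.

Lemma Z2_norm_le (x : Z2) n : Z2_norm x <= (2 ^+ n)^-1 <-> x n = 0%N.
Proof.
rewrite /Z2_norm; case: pselect => [h|/nonzero_resPn ->]; last first.
  by rewrite res2_0 invr_ge0 exprn_ge0.
case: ex_minnP => m xm mmin.
rewrite lef_pV2 ?posrE ?exprn_gt0// ler_eXn2l//.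
split=> [|xn0].
  case: n => [_|n nm]; first by have := res2_lt x 0; case: (x 0%N).
  by apply/eqP/negPn/negP => /mmin; rewrite leqNgt nm.
rewrite leqNgt; apply/negP => mn.
by move: xm; rewrite (res2_eq0_le mn xn0).
Qed.

Lemma Z2_norm_val (x : Z2) : Z2_norm x = 0 \/ exists n, Z2_norm x = (2 ^+ n)^-1.
Proof.
by rewrite /Z2_norm; case: pselect => h; [right; exists (ex_minn h)|left].
Qed.

Lemma Z2_norm_ge0 (x : Z2) : 0 <= Z2_norm x.
Proof. by case: (Z2_norm_val x) => [|[n]] ->; rewrite ?invr_ge0 ?exprn_ge0. Qed.

Lemma Z2_norm_eq0 (x : Z2) : Z2_norm x = 0 -> x = 0.
Proof.
move=> x0; apply: Z2_eq => n; rewrite res2_0.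
by apply/Z2_norm_le; rewrite x0 invr_ge0 exprn_ge0.
Qed.

Lemma Z2_norm0 : Z2_norm 0 = 0.
Proof.
rewrite /Z2_norm; case: pselect => // h; exfalso.
by case: h => n; rewrite res2_0 eqxx.
Qed.

Lemma Z2_norm_ultra (x y : Z2) : Z2_norm (x + y) <= Num.max (Z2_norm x) (Z2_norm y).
Proof.
wlog xy : x y / Z2_norm x <= Z2_norm y.
  by move=> W; case/orP: (le_total (Z2_norm x) (Z2_norm y)) => /W;
    rewrite // addrC maxC.
rewrite (max_idPr xy); case: (Z2_norm_val y) => [y0|[n yn]].
  by rewrite (Z2_norm_eq0 y0) addr0 Z2_norm0 -y0.
have /Z2_norm_le yn0 : Z2_norm y <= (2 ^+ n)^-1 by rewrite yn.
have /Z2_norm_le xn0 : Z2_norm x <= (2 ^+ n)^-1 by rewrite -yn.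
by rewrite yn; apply/Z2_norm_le; rewrite res2D xn0 yn0 mod0n.
Qed.

Lemma Z2_dist_le (x y : Z2) n : Z2_dist x y <= (2 ^+ n)^-1 <-> x n = y n.
Proof.
rewrite /Z2_dist; split=> [/Z2_norm_le/eqP|xy].
  by rewrite res2_subr_eq0 => /eqP.
by apply/Z2_norm_le/eqP; rewrite res2_subr_eq0 xy.
Qed.

Fact Z2_distxx (x : Z2) : Z2_dist x x = 0.
Proof. by rewrite /Z2_dist subrr Z2_norm0. Qed.

Fact Z2_dist_eq0 (x y : Z2) : Z2_dist x y = 0 -> x = y.
Proof. by move=> /Z2_norm_eq0/eqP; rewrite subr_eq0 => /eqP. Qed.

Fact Z2_dist_sym (x y : Z2) : Z2_dist x y = Z2_dist y x.
Proof.
have H (a b : Z2) : Z2_dist a b <= Z2_dist b a.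
  case: (Z2_norm_val (b - a)) => [ba|[n ba]]; rewrite [leRHS]ba.
    by rewrite (Z2_dist_eq0 ba) Z2_distxx.
  by apply/Z2_dist_le/esym/Z2_dist_le; rewrite /Z2_dist ba.
by apply/le_anti; rewrite !H.
Qed.

Fact Z2_dist_triangle (y x z : Z2) : Z2_dist x z <= Z2_dist x y + Z2_dist y z.
Proof.
rewrite /Z2_dist -(subrKA y x (- z)); apply: le_trans (Z2_norm_ultra _ _) _.
by rewrite ge_max lerDl lerDr !Z2_norm_ge0.
Qed.

HB.instance Definition _ := isMetric.Build rat Z2
  Z2_distxx Z2_dist_eq0 Z2_dist_sym Z2_dist_triangle.

Section Dynamics.
Context {R : numFieldType} {T : metricType R}.
Implicit Types (f : T -> T) (X P B : set T).

Definition orbit_of f (x : T) : set T := range (fun n => iter n f x).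

Definition periodic_point f (x : T) : Prop :=
  exists2 n, (0 < n)%N & iter n f x = x.

Definition finite_union_of_balls X : Prop :=
  exists s : seq (T * R), (forall p, p \in s -> 0 < p.2) /\
    X = \bigcup_(p in [set` s]) ball p.1 p.2.

(* A minimal system is nonempty by convention. *)
Definition minimal_component f X : Prop :=
  [/\ X !=set0, clopen X, f @` X `<=` X, finite_union_of_balls X
    & forall x, X x -> X `<=` closure (orbit_of f x)].

Definition attracting_basin f X : set T :=
  [set x | forall e : R, 0 < e ->
     \forall n \near \oo, exists2 y, X y & ball (iter n f x) e y].

(* The components are an indexed family [(Mi i)_(i in D)], so that [trivIset]
   asserts that components with different indices are disjoint (hence, being
   nonempty, distinct); they are exactly all the minimal components. *)
Record minimal_decomposition f P (I : Type) (D : set I) (Mi : I -> set T) B :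
    Prop := MinimalDecomposition {
  mindec_cover : P `|` (\bigcup_(i in D) Mi i) `|` B = setT;
  mindec_disjPM : P `&` (\bigcup_(i in D) Mi i) = set0;
  mindec_disjPB : P `&` B = set0;
  mindec_disjMB : (\bigcup_(i in D) Mi i) `&` B = set0;
  mindec_finite : finite_set P;
  mindec_periodic : P = [set x | periodic_point f x];
  mindec_countable : countable D;
  mindec_trivIset : trivIset D Mi;
  mindec_components :
    forall X, minimal_component f X <-> exists2 i, D i & X = Mi i;
  mindec_basin : forall x, B x ->
    (exists2 p, periodic_point f p & attracting_basin f (orbit_of f p) x) \/
    (exists2 i, D i & attracting_basin f (Mi i) x)
}.

End Dynamics.

Fixpoint fibpoly (m : nat) : {poly Z2} :=
  match m with
  | 0 => 0
  | m1.+1 => match m1 with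
             | 0 => 1
             | m2.+1 => 'X * fibpoly m1 + fibpoly m2
             end
  end.

Definition binary_digit (q i : nat) : nat := ((q %/ 2 ^ i) %% 2)%N.

(* The least i >= 1 with binary digit 1; digits at positions i > q vanish, so
   searching 1, ..., q suffices.  (Only meaningful for q >= 2.) *)
Definition u1 (q : nat) : nat :=
  (find (fun i => binary_digit q i == 1%N) (iota 1 q)).+1.

Lemma u1P (q : nat) : (2 <= q)%N ->
  [/\ (1 <= u1 q)%N, binary_digit q (u1 q) = 1%N
    & forall i, (1 <= i)%N -> binary_digit q i = 1%N -> (u1 q <= i)%N].
Proof.
move=> q2; have q0 : (0 < q)%N by exact: leq_trans q2.
pose a i := binary_digit q i == 1%N.
have ha : has a (iota 1 q).
  have /andP[l1 l2] := trunc_log_bounds (isT : (1 < 2)%N) q0.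
  apply/hasP; exists (trunc_log 2 q).
    rewrite mem_iota trunc_log_gt0 q2 /= add1n ltnS.
    by apply/ltnW/(leq_trans (ltn_expl _ (isT : (1 < 2)%N))).
  rewrite /a /binary_digit; set l := trunc_log 2 q in l1 l2 *.
  have -> : (q %/ 2 ^ l = 1)%N; last by [].
  apply/eqP; rewrite eqn_leq -ltnS ltn_divLR ?expn_gt0// -expnS l2 /=.
  by rewrite divn_gt0 ?expn_gt0.
split=> //.
- have := nth_find 0%N ha; rewrite nth_iota ?add1n => [/eqP//|].
  by rewrite -[X in (_ < X)%N](size_iota 1) -has_find.
- case=> // i _ di; rewrite /u1 ltnS leqNgt; apply/negP => lt.
  have := before_find 0%N lt; rewrite nth_iota ?add1n ?di//.
  by apply: (leq_trans lt); rewrite -[X in (_ <= X)%N](size_iota 1) find_size.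
Qed.

Definition residue_class (a : Z2) (n : nat) : set Z2 :=
  [set a + 2%:R ^+ n * z | z in [set: Z2]].

Definition A_comp (u k : nat) : set Z2 :=
  residue_class (1 + 2%:R * k%:R) (u + 3).

Definition M_comp (u n k : nat) : set Z2 :=
  residue_class ((1 + 2%:R * k%:R) * 2%:R ^+ n) (n + u + 1).

(* [inl k] indexes A_k and [inr (n, k)] indexes M_{n,k}. *)
Definition component_index (u : nat) : set (nat + nat * nat) :=
  [set i | match i with
           | inl k => (k < 2 ^ (u + 2))%N
           | inr (n, k) => (1 <= n)%N /\ (k < 2 ^ u)%N
           end].

Definition component (u : nat) (i : nat + nat * nat) : set Z2 :=
  match i with
  | inl k => A_comp u k
  | inr (n, k) => M_comp u n k
  end.

(* Main.v *)
Require Import Defs.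
From mathcomp Require Import all_boot all_order all_algebra.
From mathcomp Require Import boolp classical_sets cardinality functions.
From mathcomp Require Import topology.
From mathcomp Require Import zify ring.

(** Write [F] for the map and [q = 2 ^ u * o] with [o] odd.  Everything follows
    from two facts about [F] on the class [X] of a nonzero point modulo [2 ^ s],
    where [s] is [u + 3] for odd points and [n + u + 1] for points of valuation
    [n >= 1]: the displacement [F x - x] has valuation exactly [s] on [X], and
    [F x - F y = (x - y) * (1 + 4 * c)] on [X].

    These two facts give minimality.  By the second one,
    [F (F x) - x = (F x - x) * (2 + 4 * c)], so [F \o F] has the same properties
    with [s + 1], and [F ^ (2 ^ t)] has them with [s + t]
    ([uniform_displacement_iter]).  Hence [2 ^ t] steps flip the binary digit
    [s + t] and keep the lower ones, and an orbit can be steered to any point of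
    [X] one digit after the other ([disp_approx]); the same count shows that no
    point of [X] is periodic ([disp_aperiodic]).

    The displacement is computed from [F_(2n+2) - x = F_n * L_(n+2)] for even
    [n], with [L] the Lucas polynomials and [n = 6 * q] ([fib_sub_x]).  The
    valuation of [F_(6q)] is that of [F_6] plus [u], since doubling the index
    multiplies by a Lucas value that is 2 modulo 4 ([fib_mul6_val]); and
    [F_6 = x * (x ^ 2 + 1) * (x ^ 2 + 3)] has valuation 3 at odd points and [n]
    at points of valuation [n >= 1].

    The difference quotients of the Fibonacci polynomials satisfy a linear
    recurrence which has period 24 modulo 4.  As [q] is even, [2 + 12 * q] is 2
    modulo 24, and the quotient is that of [F_2 = x], namely 1
    ([fib_quot_mod4]).

    Finally, the classes considered partition the nonzero points
    ([component_cover], [component_inj]), so a minimal component contains a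
    point of one of them and must be equal to it ([minimal_component_eq]). *)

Set Implicit Arguments.
Unset Strict Implicit.
Unset Printing Implicit Defensive.

Import Order.TTheory GRing.Theory Num.Theory.

Local Open Scope ring_scope.
Local Open Scope classical_set_scope.

(** * Divisibility by powers of two in Z2 *)

Lemma res2_exp2 n : (2 ^+ n : Z2) n = 0%N.
Proof. by rewrite -natrX res2_natr modnn. Qed.

Lemma res2_exp2M n (z : Z2) : (2 ^+ n * z) n = 0%N.
Proof. by rewrite res2M res2_exp2 mul0n mod0n. Qed.

Lemma res2_addl_mod (x : Z2) n k : (x (n + k) %% 2 ^ n)%N = x n.
Proof.
elim: k => [|k IH]; first by rewrite addn0 res2_modn.
by rewrite -IH -(res2_compat x (n + k)) addnS modn_dvdm// dvdn_exp2l// leq_addr.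
Qed.

(** The quotient by [2 ^+ n] is read off the residues of [x] shifted by [n]
    levels. *)
Lemma res2_eq0_dvd (x : Z2) n : x n = 0%N -> exists z, x = 2 ^+ n * z.
Proof.
move=> xn0.
have dvd k : (2 ^ n %| x (n + k))%N by rewrite /dvdn res2_addl_mod xn0.
have compat k : ((x (n + k.+1) %/ 2 ^ n) %% 2 ^ k)%N = (x (n + k) %/ 2 ^ n)%N.
  by rewrite modn_divl -expnD [(k + n)%N]addnC addnS res2_compat.
exists (MkZ2 compat); apply: Z2_eq => k.
rewrite res2M -natrX res2_natr /= modnMml mulnC divnK//.
by rewrite addnC res2_addl_mod.
Qed.

Lemma res2_eq_sub (x y : Z2) n : x n = y n <-> exists z, x - y = 2 ^+ n * z.
Proof.
split=> [xy|[z xy]].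
  by apply: res2_eq0_dvd; apply/eqP; rewrite res2_subr_eq0 xy.
by apply/eqP; rewrite -res2_subr_eq0 xy res2_exp2M.
Qed.

Lemma res2_eqP (x y : Z2) n : x n = y n <-> exists z, x = y + 2 ^+ n * z.
Proof.
split=> [/res2_eq_sub[z xy]|[z ->]]; first by exists z; rewrite -xy addrC subrK.
by apply/res2_eq_sub; exists z; rewrite addrC addKr.
Qed.

Lemma residue_classP (a : Z2) n (x : Z2) : residue_class a n x <-> x n = a n.
Proof.
rewrite res2_eqP /residue_class /=; split=> [[z _ <-]|[z ->]]; first by exists z.
by exists z.
Qed.

(** This says that the 2-adic valuation of [x] is [n]: the units of Z2 are the
    [1 + 2 * c]. *)
Definition has_val (n : nat) (x : Z2) := exists c, x = 2 ^+ n * (1 + 2 * c).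

Lemma has_val_res2 n (x : Z2) : has_val n x -> x n.+1 = (2 ^ n)%N.
Proof.
move=> [c ->]; have -> : 2 ^+ n * (1 + 2 * c) = (2 ^ n)%:R + 2 ^+ n.+1 * c :> Z2.
  by rewrite natrX exprS; ring.
by rewrite res2D res2_exp2M addn0 res2_modn res2_natr modn_small// ltn_exp2l.
Qed.

Lemma has_val_dvd n (x : Z2) : has_val n x -> x n = 0%N.
Proof. by move=> [c ->]; exact: res2_exp2M. Qed.

Lemma has_val_neq0 n (x : Z2) : has_val n x -> x <> 0.
Proof.
move=> /has_val_res2 + x0; rewrite x0 res2_0 => /esym/eqP.
by rewrite expn_eq0.
Qed.

Lemma has_val_inj n m (x : Z2) : has_val n x -> has_val m x -> n = m.
Proof.
wlog lenm : n m / (n <= m)%N => [W xn xm|].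
  by case: (leqP n m) => [/W|/ltnW/W] => [|E]; [exact|exact/esym/E].
move=> /has_val_res2 xn /has_val_dvd xm; apply/eqP; rewrite eqn_leq lenm leqNgt.
apply/negP => /res2_eq0_le/(_ xm); rewrite xn => /eqP.
by rewrite expn_eq0.
Qed.

Lemma has_val_exists (x : Z2) : x <> 0 -> exists n, has_val n x.
Proof.
move=> x0; have [n xn] : nonzero_res x.
  by apply: contrapT => /nonzero_resPn.
have ex : exists n, x n.+1 != 0%N by exists n.
case: (ex_minnP ex) => {n xn} n xn nmin; exists n.
have xn0 : x n = 0%N.
  case: n nmin {xn} => [|n] nmin; first by have := res2_lt x 0; case: (x 0%N).
  by apply/eqP/negPn/negP => /nmin; rewrite ltnn.
have [z xE] := res2_eq0_dvd xn0.
have z1 : z 1%N = 1%N.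
  have := res2_lt z 1; case: (boolP (z 1%N == 0%N)) => [/eqP z1 _|]; last by lia.
  have [w zE] := res2_eq0_dvd z1.
  by move: xn; rewrite xE zE expr1 mulrA -exprSr res2_exp2M.
have : z 1%N = (1 : Z2) 1%N by rewrite z1.
by move=> /res2_eqP[c zE]; exists c; rewrite xE zE expr1.
Qed.

Lemma has_valM n m (x y : Z2) :
  has_val n x -> has_val m y -> has_val (n + m) (x * y).
Proof.
by move=> [c ->] [e ->]; exists (c + e + 2 * c * e); rewrite exprD; ring.
Qed.

Lemma has_val_add n (x y : Z2) :
  has_val n x -> (exists c, y = 2 ^+ n.+1 * c) -> has_val n (x + y).
Proof. by move=> [c ->] [e ->]; exists (c + e); rewrite exprS; ring. Qed.

Lemma has_val_mul_odd n (x c : Z2) : has_val n x -> has_val n (x * (1 + 2 * c)).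
Proof.
move=> xn; rewrite -[n]addn0; apply: has_valM => //; exists c.
by rewrite expr0 mul1r.
Qed.

Lemma parity (x : Z2) : (exists c, x = 2 * c) \/ (exists c, x = 1 + 2 * c).
Proof.
have := res2_lt x 1; case: (boolP (x 1%N == 0%N)) => [/eqP x1 _|x1 lt].
  by left; have [z ->] := res2_eq0_dvd x1; exists z; rewrite expr1.
have : x 1%N = (1 : Z2) 1%N by have -> : (1 : Z2) 1%N = 1%N by []; lia.
by move=> /res2_eqP[z ->]; right; exists z; rewrite expr1.
Qed.

(** * The topology of Z2 *)

Lemma inv_exp2_lt (e : rat) : 0 < e -> exists n, (2 ^+ n)^-1 < e.
Proof.
move=> e0; exists (Num.bound e^-1).
rewrite -[ltRHS]invrK ltf_pV2 ?posrE ?invr_gt0 ?exprn_gt0//.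
apply: lt_trans (archi_boundP _) _; first by rewrite invr_ge0 ltW.
by rewrite -natrX ltr_nat ltn_expl.
Qed.

Lemma ball_res2 (x : Z2) n : ball x (2 ^+ n)^-1%R `<=` [set y : Z2 | y n = x n].
Proof.
move=> y; rewrite ballEmdist /= => /ltW xy.
by apply/esym/Z2_dist_le.
Qed.

(** Distances are 0 or a power of 1/2, so the closed ball of radius [2 ^- n] is
    the open ball of radius [2 * 2 ^- n]. *)
Lemma ball_double (x y : Z2) n : ball x (2 * (2 ^+ n)^-1%R) y <-> y n = x n.
Proof.
rewrite ballEmdist /=; have -> : mdist x y = Z2_dist x y by [].
split=> [xy|/esym/Z2_dist_le le]; last first.
  by apply: le_lt_trans le _; rewrite ltr_pMl ?invr_gt0 ?exprn_gt0// ltr1n.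
apply/esym/Z2_dist_le; move: xy; rewrite /Z2_dist.
case: (Z2_norm_val (x - y)) => [->|[k ->]]; first by rewrite invr_ge0 exprn_ge0.
have -> : 2 * (2 ^+ n)^-1 = (2 ^+ n / 2)^-1 :> rat by rewrite invfM invrK mulrC.
rewrite ltf_pV2 ?posrE ?mulr_gt0 ?invr_gt0 ?exprn_gt0// ltr_pdivrMr//.
rewrite -exprSr ltr_eXn2l// ltnS => nk.
by rewrite lef_pV2 ?posrE ?exprn_gt0// ler_eXn2l.
Qed.

Lemma open_res2 n (P : set nat) : open [set x : Z2 | P (x n)].
Proof.
rewrite openE => x /= Px; apply/nbhs_ballP; exists (2 ^+ n)^-1 => /=.
  by rewrite invr_gt0 exprn_gt0.
by move=> y /ball_res2 /= ->.
Qed.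

Lemma clopen_residue_class a n : clopen (residue_class a n).
Proof.
have -> : residue_class a n = [set x : Z2 | x n = a n].
  by apply/seteqP; split=> x /residue_classP.
split; first exact: (@open_res2 n [set k | k = a n]).
rewrite -openC; exact: (@open_res2 n [set k | k <> a n]).
Qed.

Lemma closure_res2 (A : set Z2) (y : Z2) :
  (forall n, exists2 x, A x & x n = y n) -> closure A y.
Proof.
move=> H B /nbhs_ballP[e /= e0 yB]; have [n ne] := inv_exp2_lt e0.
have [x Ax xy] := H n; exists x; split=> //; apply: yB.
rewrite ballEmdist /=; apply: le_lt_trans ne.
exact/Z2_dist_le/esym.
Qed.

Lemma residue_class_ball a n : finite_union_of_balls (residue_class a n).
Proof.
exists [:: (a, 2 * (2 ^+ n)^-1)]; split.
  by move=> p; rewrite inE => /eqP -> /=; rewrite mulr_gt0 ?invr_gt0 ?exprn_gt0.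
apply/seteqP; split=> x.
  move=> /residue_classP xa; exists (a, 2 * (2 ^+ n)^-1); first by rewrite /= inE.
  exact/ball_double.
by move=> [p /=]; rewrite inE => /eqP -> /= /ball_double xa; exact/residue_classP.
Qed.

(** * Minimality from a constant displacement valuation *)

(** The condition on difference quotients stands for a derivative congruent to 1
    modulo 4; in this form it is visibly stable under composition. *)
Record uniform_displacement (X : set Z2) (f : Z2 -> Z2) (s : nat) : Prop := {
  disp_stable : forall x, X x -> X (f x);
  disp_val : forall x, X x -> has_val s (f x - x);
  disp_quot : forall x y, X x -> X y ->
    exists c, f x - f y = (x - y) * (1 + 4 * c)
}.

(** [f (f x) - x] is [f (f x) - f x] plus [f x - x], and the former is the latter
    times [1 + 4 * c]; so squaring multiplies the displacement by [2 + 4 * c]. *)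
Lemma uniform_displacement_square X f s :
  uniform_displacement X f s -> uniform_displacement X (f \o f) s.+1.
Proof.
move=> [fX fval fq]; split=> [x Xx|x Xx|x y Xx Xy] /=; first exact/fX/fX.
- have [c fc] := fq _ _ (fX _ Xx) Xx; have [e fe] := fval _ Xx.
  exists (c + e + 2 * c * e); rewrite -(subrKA (f x)) fc fe exprS; ring.
- have [c fc] := fq _ _ (fX _ Xx) (fX _ Xy); have [e fe] := fq _ _ Xx Xy.
  by exists (c + e + 4 * c * e); rewrite fc fe; ring.
Qed.

Lemma uniform_displacement_iter X f s t :
  uniform_displacement X f s -> uniform_displacement X (iter (2 ^ t) f) (s + t).
Proof.
move=> fX; elim: t => [|t /uniform_displacement_square]; first by rewrite addn0.
rewrite addnS; have -> // : iter (2 ^ t) f \o iter (2 ^ t) f = iter (2 ^ t.+1) f.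
by apply/funext => x; rewrite /= -iterD addnn -mul2n -expnS.
Qed.

Lemma disp_stable_iter X f s n x :
  uniform_displacement X f s -> X x -> X (iter n f x).
Proof. by move=> fX Xx; elim: n => //= n; exact: disp_stable fX _. Qed.

Lemma disp_sum X f s n x : uniform_displacement X f s -> X x ->
  exists c, iter n f x - x = (f x - x) * (n%:R + 4 * c).
Proof.
move=> fX Xx; elim: n => [|n [c IH]]; first by exists 0; rewrite /=; ring.
have [e fe] := disp_quot fX (disp_stable_iter n fX Xx) Xx.
exists (c + e * (n%:R + 4 * c)); rewrite iterS -(subrKA (f x)) fe IH.
by rewrite -natr1; ring.
Qed.

(** If [n = 2 ^ t * o] with [o] odd, then [f ^ n] is the [o]-th iterate of a map
    with displacement valuation [s + t], and [o + 4 * c] is a unit. *)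
Lemma disp_aperiodic X f s n x : uniform_displacement X f s -> X x ->
  (0 < n)%N -> iter n f x <> x.
Proof.
move=> fX Xx n0; have [o cop ->] := pfactor_coprime (isT : prime 2) n0.
have oddo : odd o by rewrite -coprime2n.
move: (logn 2 n) => t; rewrite iterM => gx.
have gX := uniform_displacement_iter t fX; have [c gc] := disp_sum o gX Xx.
have := disp_val gX Xx => /(has_val_mul_odd ((o./2)%:R + 2 * c)) /has_val_neq0.
apply; rewrite -[RHS](subrr x) -[in X in _ = X - _]gx gc.
have -> : o%:R = 1 + 2 * (o./2)%:R :> Z2.
  by rewrite -[in LHS](odd_double_half o) oddo natrD -muln2 natrM mulrC.
by ring.
Qed.

(** Given an orbit point that agrees with [y] modulo [2 ^ (s + t)], either it
    also agrees with [y] modulo [2 ^ (s + t + 1)], or [2 ^ t] further steps move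
    it by an odd multiple of [2 ^ (s + t)] and so correct the next digit. *)
Lemma disp_approx a s f x y t :
  uniform_displacement (residue_class a s) f s ->
  residue_class a s x -> residue_class a s y ->
  exists n, iter n f x (s + t)%N = y (s + t)%N.
Proof.
move=> fX Xx Xy; elim: t => [|t [n]].
  exists 0%N; rewrite addn0 /=.
  by move: Xx Xy => /residue_classP -> /residue_classP ->.
set z := iter n f x => /res2_eq_sub[w zw].
have Xz : residue_class a s z by exact: disp_stable_iter fX Xx.
have [[c wc]|[c wc]] := parity w.
  exists n; apply/res2_eq_sub; exists c.
  by rewrite -/z zw wc addnS exprSr; ring.
have [e ge] := disp_val (uniform_displacement_iter t fX) Xz.
exists (2 ^ t + n)%N; apply/res2_eq_sub; exists (1 + c + e).
by rewrite iterD -/z -(subrKA z) ge zw wc addnS exprSr; ring.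
Qed.

Lemma disp_minimal a s f x :
  uniform_displacement (residue_class a s) f s -> residue_class a s x ->
  residue_class a s `<=` closure (orbit_of f x).
Proof.
move=> fX Xx y Xy; apply: closure_res2 => n.
have [k kn] := disp_approx n fX Xx Xy.
exists (iter k f x); first by exists k.
by rewrite -(res2_addl_mod _ n s) addnC kn addnC res2_addl_mod.
Qed.

Lemma disp_minimal_component a s f :
  uniform_displacement (residue_class a s) f s ->
  minimal_component f (residue_class a s).
Proof.
move=> fX; split.
- by exists a; apply/residue_classP.
- exact: clopen_residue_class.
- by move=> _ [x Xx <-]; exact: disp_stable fX _ Xx.
- exact: residue_class_ball.
- by move=> x; exact: disp_minimal.
Qed.

(** A closed invariant set contains the closure of each of its orbits, so two
    minimal components with a common point are both equal to the closure of the
    orbit of that point. *)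
Lemma minimal_component_eq (R : numFieldType) (T : metricType R) (f : T -> T)
    (X Y : set T) x :
  minimal_component f X -> minimal_component f Y -> X x -> Y x -> X = Y.
Proof.
have sub (A B : set T) : minimal_component f A -> minimal_component f B ->
    A x -> B x -> A `<=` B.
  move=> [_ _ _ _ Amin] [_ [_ Bcl] fB _ _] Ax Bx.
  apply: subset_trans (Amin x Ax) _.
  rewrite [X in _ `<=` X](closure_id B).1//; apply: closure_subset.
  by move=> _ [n _ <-]; elim: n => //= n IH; apply: fB; exists (iter n f x).
by move=> Xmin Ymin Xx Yx; apply/seteqP; split; exact: sub.
Qed.

(** * Fibonacci polynomials *)

Section FibonacciValues.
Variable x : Z2.

Local Notation F n := (fibpoly n).[x].

Lemma fib0 : F 0 = 0. Proof. exact: horner0. Qed.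

Lemma fib1 : F 1 = 1. Proof. exact: hornerC. Qed.

Lemma fibSS n : F n.+2 = x * F n.+1 + F n.
Proof. by rewrite [fibpoly _]/= hornerD hornerM hornerX. Qed.

Lemma fib_add n m : F (n + m).+1 = F n.+1 * F m.+1 + F n * F m.
Proof.
elim: m n => [|m IH] n; first by rewrite addn0 fib1 fib0; ring.
by rewrite addnS -addSn IH (fibSS n) (fibSS m); ring.
Qed.

Lemma fib_double n : F (2 * n) = F n * (2 * F n.+1 - x * F n).
Proof.
case: n => [|n]; first by rewrite muln0 fib0 mul0r.
by rewrite mul2n -addnn addSn addnS -addSn fib_add fibSS; ring.
Qed.

Lemma fib_Cassini n :
  F n.+1 ^+ 2 - x * F n * F n.+1 - F n ^+ 2 = (-1) ^+ n.
Proof.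
elim: n => [|n IH]; first by rewrite fib1 fib0; ring.
by rewrite [RHS]exprS -IH fibSS; ring.
Qed.

(** The second factor is the Lucas polynomial of index [n + 2]; this is
    [F (a + b) - F (a - b) = L a * F b] for even [b], at [a = n + 2], [b = n]. *)
Lemma fib_sub_x n : ~~ odd n ->
  F (2 + 2 * n) - x = F n * (F n.+1 * (2 + x ^+ 2) + x * F n).
Proof.
move=> evn; have := fib_Cassini n; rewrite -signr_odd (negbTE evn) expr0 => C.
have -> : F (2 + 2 * n) = F n.+1 * (x * F n.+1 + 2 * F n).
  have -> : (2 + 2 * n = (n.+1 + n).+1)%N by lia.
  by rewrite fib_add fibSS; ring.
by rewrite -[X in _ - X]mulr1 -C; ring.
Qed.

Lemma fib5 : F 5 = x ^+ 4 + 3 * x ^+ 2 + 1.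
Proof. by rewrite !fibSS fib1 fib0; ring. Qed.

Lemma fib6 : F 6 = x * ((x ^+ 2 + 1) * (x ^+ 2 + 3)).
Proof. by rewrite !fibSS fib1 fib0; ring. Qed.

Lemma pronic_even (c : Z2) : exists e, c * (c + 1) = 2 * e.
Proof.
have [[e ->]|[e ->]] := parity c; first by exists (e * (2 * e + 1)); ring.
by exists ((1 + 2 * e) * (1 + e)); ring.
Qed.

Lemma fib5_odd : exists c, F 5 = 1 + 2 * c.
Proof.
rewrite fib5; have [[c ->]|[c ->]] := parity x.
  by exists (8 * c ^+ 4 + 6 * c ^+ 2); ring.
(* Here [x ^+ 2 = 1 + 4 * (c ^+ 2 + c)]. *)
exists (2 + 10 * (c ^+ 2 + c) + 8 * (c ^+ 2 + c) ^+ 2); ring.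
Qed.

(** For odd [x] one has [x ^+ 2 = 1 + 8 * e], so the factors [x ^+ 2 + 1] and
    [x ^+ 2 + 3] have valuations 1 and 2; for even [x] both are odd. *)
Lemma fib6_val n : has_val n x -> has_val (if n is 0 then 3 else n) (F 6).
Proof.
rewrite fib6; case: n => [|n] [c xc].
  have [e ce] := pronic_even c.
  have x2 : x ^+ 2 = 1 + 8 * e.
    have -> : 8 * e = 4 * (c * (c + 1)) by rewrite ce; ring.
    by rewrite xc; ring.
  rewrite x2; apply: (@has_valM 0 3); first by exists c.
  by apply: (@has_valM 1 2); [exists (2 * e)|exists e]; ring.
rewrite -[n.+1]addn0; apply: has_valM; first by exists c.
pose y := 2 ^+ n * (1 + 2 * c).
have -> : x = 2 * y by rewrite xc /y exprS; ring.
apply: (@has_valM 0 0); [exists (2 * y ^+ 2)|exists (1 + 2 * y ^+ 2)]; ring.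
Qed.

Lemma fib6_even : exists c, F 6 = 2 * c.
Proof.
rewrite fib6; have [[c xc]|[c xc]] := parity x.
  by exists (c * ((x ^+ 2 + 1) * (x ^+ 2 + 3))); rewrite {1}xc; ring.
exists (x * ((1 + 2 * c + 2 * c ^+ 2) * (x ^+ 2 + 3))).
by rewrite xc; ring.
Qed.

Lemma x_fib6_dvd4 : exists c, x * F 6 = 4 * c.
Proof.
rewrite fib6; have [[c xc]|[c xc]] := parity x.
  by exists (c ^+ 2 * ((x ^+ 2 + 1) * (x ^+ 2 + 3))); rewrite xc; ring.
exists (x ^+ 2 * ((1 + 2 * c + 2 * c ^+ 2) * 2 * (1 + c + c ^+ 2))).
by rewrite xc; ring.
Qed.

Lemma fib_mul6 k :
  (exists c, F (6 * k) = F 6 * c) /\ (exists c, F (6 * k).+1 = 1 + 2 * c).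
Proof.
elim: k => [|k [[c kc] [e ke]]].
  by rewrite muln0 fib0 fib1; split; exists 0; ring.
have [a F5] := fib5_odd; have [b F6] := fib6_even.
split.
  exists (F (6 * k).+1 + F 5 * c).
  have -> : (6 * k.+1 = (6 * k + 5).+1)%N by lia.
  by rewrite fib_add kc; ring.
have -> : (6 * k.+1 = 6 * k + 6)%N by lia.
rewrite fib_add fibSS kc ke F6 F5.
by exists (e + a + 2 * e * a + x * b + 2 * e * x * b + 2 * b * c * b); ring.
Qed.

Lemma fib_mul6_val_odd v j : has_val v (F 6) -> has_val v (F (6 * j.*2.+1)).
Proof.
move=> F6v; elim: j => [|j IH] //.
have -> : (6 * j.+1.*2.+1 = (6 * j.*2.+1 + 11).+1)%N by lia.
rewrite fib_add addrC.
have [a F5] := fib5_odd; have [b F6] := fib6_even.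
have -> : F 11 = 1 + 2 * (2 * b ^+ 2 + 2 * a + 2 * a ^+ 2).
  by rewrite (fib_add 5 5) F5 F6; ring.
have -> : F 12 = F 6 * (2 * (F 7 - x * b)).
  by rewrite (fib_double 6) [in x * F 6]F6; ring.
apply: has_val_add; first exact: has_val_mul_odd.
have [c ->] := F6v; exists ((1 + 2 * c) * (F 7 - x * b) * F (6 * j.*2.+1).+1).
by rewrite exprS; ring.
Qed.

(** Doubling the index multiplies the value by [2 * F n.+1 - x * F n], which is
    2 modulo 4 when [6 %| n]. *)
Lemma fib_mul6_val v t o : odd o -> has_val v (F 6) ->
  has_val (v + t) (F (6 * (2 ^ t * o))).
Proof.
move=> oddo F6v; elim: t => [|t IH].
  rewrite addn0 expn0 mul1n -(odd_double_half o) oddo add1n.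
  exact: fib_mul6_val_odd.
have -> : (6 * (2 ^ t.+1 * o) = 2 * (6 * (2 ^ t * o)))%N by rewrite expnS; ring.
have [[c kc] [e ke]] := fib_mul6 (2 ^ t * o); have [b xF6] := x_fib6_dvd4.
rewrite fib_double addnS -addn1; apply: has_valM => //.
by exists (e - b * c); rewrite ke kc [x * _]mulrA xF6; ring.
Qed.

(** The Lucas factor of [fib_sub_x] is odd for odd [x] and 2 modulo 4 for even
    [x], [F 6] contributes 3, respectively the valuation of [x], and the [u]
    doublings contribute [u]. *)
Lemma fib_displacement n u o : odd o -> has_val n x ->
  has_val (if n is 0 then u + 3 else n + u + 1)
    (F (2 + 12 * (2 ^ u * o)) - x).
Proof.
move=> oddo xn.
have -> : (12 * (2 ^ u * o) = 2 * (6 * (2 ^ u * o)))%N by ring.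
rewrite fib_sub_x; last by rewrite oddM.
have Fv := fib_mul6_val u oddo (fib6_val xn).
have [[c kc] [e ke]] := fib_mul6 (2 ^ u * o); have [b F6] := fib6_even.
rewrite ke; case: n xn Fv => [|n] [a xa] Fv.
  rewrite [(u + 3)%N]addnC -[(3 + u)%N]addn0; apply: has_valM => //.
  exists ((1 + 2 * a) * (b * c) + 1 + 2 * (a + a ^+ 2)
    + e * (3 + 4 * (a + a ^+ 2))).
  by rewrite kc F6 xa; ring.
apply: has_valM => //; pose y := 2 ^+ n * (1 + 2 * a).
have xE : x = 2 * y by rewrite xa /y exprS; ring.
exists (e * (1 + 2 * y ^+ 2) + y ^+ 2 + y * b * c).
by rewrite kc F6 xE; ring.
Qed.

End FibonacciValues.

(** * Difference quotients modulo 4 *)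

Fixpoint fib_quot (x y : Z2) (n : nat) : Z2 :=
  match n with
  | 0 => 0
  | n1.+1 => match n1 with
             | 0 => 0
             | n2.+1 =>
               x * fib_quot x y n1 + fib_quot x y n2 + (fibpoly n1).[y]
             end
  end.

Lemma fib_quotE (x y : Z2) n :
  (fibpoly n).[x] - (fibpoly n).[y] = (x - y) * fib_quot x y n.
Proof.
suff [] : (fibpoly n).[x] - (fibpoly n).[y] = (x - y) * fib_quot x y n /\
  (fibpoly n.+1).[x] - (fibpoly n.+1).[y] = (x - y) * fib_quot x y n.+1 by [].
elim: n => [|n [IH1 IH2]]; first by rewrite !fib0 !fib1 /= !mulr0 !subrr.
split=> //; rewrite !fibSS.
have -> : fib_quot x y n.+2 =
  x * fib_quot x y n.+1 + fib_quot x y n + (fibpoly n.+1).[y] by [].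
rewrite !mulrDr [(x - y) * (x * _)]mulrCA -IH1 -IH2; ring.
Qed.

(** The recurrence for two consecutive values of [fibpoly] and of [fib_quot],
    reduced modulo 4, at arguments congruent to [r]. *)
Definition fib_step (r : nat) (st : (nat * nat) * (nat * nat)) :=
  let: ((a, b), (c, d)) := st in
  ((b, (r * b + a) %% 4), (d, (r * d + c + b) %% 4))%N.

Lemma fib_stepE (x y : Z2) n : x 2%N = y 2%N ->
  iter n (fib_step (y 2%N)) ((0, 1), (0, 0))%N =
  (((fibpoly n).[y] 2, (fibpoly n.+1).[y] 2),
   (fib_quot x y n 2, fib_quot x y n.+1 2))%N.
Proof.
move=> xy; elim: n => [|n IH].
  by rewrite fib0 fib1 ![fib_quot _ _ _]/= !res2_0.
rewrite iterS IH /fib_step fibSS.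
have -> : fib_quot x y n.+2 =
  x * fib_quot x y n.+1 + fib_quot x y n + (fibpoly n.+1).[y] by [].
have modnDDml a b c : ((a %% 2 ^ 2 + b + c) %% 2 ^ 2 = (a + b + c) %% 2 ^ 2)%N.
  by rewrite -!addnA modnDml.
by rewrite !res2D !res2M xy !modnDml modnDDml.
Qed.

(** Only four residues [r] occur, so that 24 is a period is checked by running
    the recurrence. *)
Lemma fib_step_period r k : (r < 4)%N ->
  iter (24 * k) (fib_step r) ((0, 1), (0, 0))%N = ((0, 1), (0, 0))%N.
Proof.
move=> r4; elim: k => // k IH; rewrite mulnS iterD IH.
by case: r r4 {IH} => [|[|[|[|]]]].
Qed.

(** By periodicity the quotient agrees modulo 4 with the one of [fibpoly 2],
    which is the identity. *)
Lemma fib_quot_mod4 (x y : Z2) k : x 2%N = y 2%N ->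
  exists c, fib_quot x y (2 + 24 * k) = 1 + 4 * c.
Proof.
move=> xy; have := fib_stepE (2 + 24 * k) xy.
rewrite iterD fib_step_period; last exact: (res2_lt y 2).
move=> /(congr1 (fun st => st.2.1)).
have -> : (iter 2 (fib_step (y 2%N)) (0, 1, (0, 0))).2.1%N = (1 : Z2) 2%N.
  by rewrite /= muln0.
by move=> /esym/res2_eqP[c ->]; exists c; congr (_ + _ * c); ring.
Qed.

(** * The components *)

(** Digit 0 of an even [q] vanishes, so the least nonzero digit of positive index
    is the least nonzero digit, and its index is the valuation of [q]. *)
Lemma u1_decomp q : (2 <= q)%N -> ~~ odd q ->
  [/\ (1 <= u1 q)%N & exists2 o, odd o & q = (2 ^ u1 q * o)%N].
Proof.
move=> q2 evq; have [u_gt0 digit_u digit_min] := u1P q2; split=> //.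
have dvd i : (i <= u1 q)%N -> (2 ^ i %| q)%N.
  elim: i => [|i IH] iu; first by rewrite dvd1n.
  have /dvdnP[r qE] := IH (ltnW iu).
  suff : (2 %| r)%N by rewrite qE expnS => /dvdnP[p ->]; rewrite -mulnA dvdn_mull.
  case: i iu qE {IH} => [|i] iu qE; first by rewrite dvdn2; lia.
  rewrite dvdn2; apply/negP => oddr; have := digit_min i.+1 isT.
  rewrite /binary_digit qE mulnK ?expn_gt0// modn2 oddr => /(_ erefl).
  by rewrite -qE leqNgt iu.
have /dvdnP[o qE] := dvd _ (leqnn _); exists o; last by rewrite mulnC.
by move: digit_u; rewrite /binary_digit {1}qE mulnK ?expn_gt0// modn2; case: odd.
Qed.

(** The family [A_k] fits the pattern of [M_{n,k}] with [n = 0] and two more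
    free binary digits: the component of index [i] consists of the points
    [2 ^ n * (1 + 2 * c)], [c] congruent to [k] modulo [2 ^ w], for the following
    [n], [k] and [w]. *)
Definition index_val (i : nat + nat * nat) : nat :=
  if i is inr (n, _) then n else 0.

Definition index_num (i : nat + nat * nat) : nat :=
  match i with inl k => k | inr (_, k) => k end.

Definition index_width (u : nat) (i : nat + nat * nat) : nat :=
  if i is inr _ then u else u + 2.

Definition index_level (u : nat) (i : nat + nat * nat) : nat :=
  index_val i + index_width u i + 1.

Lemma componentE u i : component u i =
  residue_class ((1 + 2 * (index_num i)%:R) * 2 ^+ index_val i) (index_level u i).
Proof.
case: i => [k|[n k]] //=.
by rewrite /A_comp expr0 mulr1 /index_level /= add0n -addnA.
Qed.

Lemma index_num_lt u i : component_index u i ->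
  (index_num i < 2 ^ index_width u i)%N.
Proof. by case: i => [k|[n k]] //= []. Qed.

Lemma componentP u i (x : Z2) : component u i x <->
  exists z, x = 2 ^+ index_val i *
    (1 + 2 * ((index_num i)%:R + 2 ^+ index_width u i * z)).
Proof.
rewrite componentE residue_classP res2_eqP /index_level.
by split=> -[z ->]; exists z; rewrite !exprD expr1; ring.
Qed.

Lemma component_val u i (x : Z2) : component u i x -> has_val (index_val i) x.
Proof.
by move=> /componentP[z ->]; exists ((index_num i)%:R + 2 ^+ index_width u i * z).
Qed.

Lemma component_cover u (x : Z2) : x <> 0 ->
  exists2 i, component_index u i & component u i x.
Proof.
move=> /has_val_exists[n [c xc]].
have split w : exists z, c = (c w)%:R + 2 ^+ w * z.
  by apply/res2_eqP; rewrite res2_natr res2_modn.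
case: n xc => [|n] xc.
  have [z cz] := split (u + 2)%N.
  exists (inl (c (u + 2)%N)); first exact: res2_lt.
  by apply/componentP; exists z; rewrite /= -cz.
have [z cz] := split u.
exists (inr (n.+1, c u)); first by split=> //; exact: res2_lt.
by apply/componentP; exists z; rewrite /= -cz.
Qed.

(** The centre [(1 + 2 * k) * 2 ^ n] of a component is smaller than
    [2 ^ index_level], hence is the residue of all its points. *)
Lemma component_inj u i j (x : Z2) : component_index u i -> component_index u j ->
  component u i x -> component u j x -> i = j.
Proof.
have res l : component_index u l -> component u l x ->
    x (index_level u l) = ((1 + 2 * index_num l) * 2 ^ index_val l)%N.
  move=> /index_num_lt lt; rewrite componentE => /residue_classP ->.
  have -> : (1 + 2 * (index_num l)%:R) * 2 ^+ index_val l =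
      ((1 + 2 * index_num l) * 2 ^ index_val l)%:R :> Z2.
    by rewrite natrM natrD natrM natrX.
  rewrite res2_natr modn_small//.
  by rewrite /index_level; move: lt; rewrite !expnD; nia.
move=> iu ju ix jx; have := has_val_inj (component_val ix) (component_val jx).
move=> valE; have widthE : index_width u i = index_width u j.
  case: i j iu ju valE {ix jx} => [k|[n k]] [l|[m l]] //= => [_ []|[]].
    by move=> + _ mE; rewrite -mE.
  by move=> + _ _ mE; rewrite mE.
have := res _ iu ix; rewrite /index_level valE widthE (res _ ju jx).
have p0 : (0 < 2 ^ index_val j)%N by rewrite expn_gt0.
move=> /eqP; rewrite eqn_pmul2r// => /eqP numE.
case: i j iu ju valE numE {ix jx widthE p0 res} => [k|[n k]] [l|[m l]] //=.
- by move=> _ _ _ E; congr inl; lia.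
- by move=> _ [m0 _] mE; move: m0; rewrite -mE.
- by move=> [n0 _] _ mE; move: n0; rewrite mE.
- by move=> _ _ -> E; congr (inr (_, _)); lia.
Qed.

Lemma fib_uniform_displacement u o i : odd o -> (1 <= u)%N ->
  component_index u i ->
  uniform_displacement (component u i)
    (fun x => (fibpoly (2 + 12 * (2 ^ u * o))).[x]) (index_level u i).
Proof.
move=> oddo u_gt0 iu.
have disp x : component u i x -> has_val (index_level u i)
    ((fibpoly (2 + 12 * (2 ^ u * o))).[x] - x).
  move=> /component_val /(fib_displacement u oddo).
  case: i iu => [k _|[[|n] k] [] // _ _] //.
  by have -> : index_level u (inl k) = (u + 3)%N by rewrite /index_level /=; lia.
split=> // [x ix|x y].
  move: (ix) (disp x ix) => + /has_val_dvd/eqP; rewrite res2_subr_eq0 => + /eqP xE.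
  by rewrite componentE => /residue_classP xa; apply/residue_classP; rewrite xE.
rewrite componentE => /residue_classP xa /residue_classP ya.
have xy : x 2%N = y 2%N.
  have lvl : (2 <= index_level u i)%N.
    by rewrite /index_level; case: (i) => [?|[? ?]] /=; lia.
  rewrite -(res2_addl_mod x 2 (index_level u i - 2)) subnKC// xa -ya.
  by rewrite -[X in y X](subnKC lvl) res2_addl_mod.
(* This is where the evenness of [2 ^ u * o] is used. *)
have -> : (2 + 12 * (2 ^ u * o) = 2 + 24 * (2 ^ u.-1 * o))%N.
  by rewrite -{1}(prednK u_gt0) expnS; ring.
have [c qE] := fib_quot_mod4 (2 ^ u.-1 * o) xy.
by exists c; rewrite fib_quotE qE.
Qed.

(** The point 0 is not isolated: it is the limit of the [2 ^+ n]. *)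
Lemma open_has_nonzero (X : set Z2) :
  open X -> X !=set0 -> exists2 y, X y & y <> 0.
Proof.
rewrite openE => Xopen [x Xx]; have [x0|/eqP x0] := eqVneq x 0; last by exists x.
have /nbhs_ballP[e /= e0 eX] := Xopen _ Xx; have [n ne] := inv_exp2_lt e0.
exists (2 ^+ n); last by apply: (@has_val_neq0 n); exists 0; ring.
apply: eX; rewrite ballEmdist /=; apply: le_lt_trans ne.
by apply/Z2_dist_le; rewrite x0 res2_0 res2_exp2.
Qed.

Lemma trivIset_component u : trivIset (component_index u) (component u).
Proof. by move=> i j iu ju [x [ix jx]]; exact: component_inj iu ju ix jx. Qed.

Theorem theorem5p4 (d : nat) :
  let q := (2 + 2 * d)%N in
  let m := (2 + 12 * q)%N in
  let u := u1 q in
  let F := fun x : Z2 => (fibpoly m).[x] in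
  [/\ [set: Z2] =
        [set 0] `|`
        ((\bigcup_(k in [set k | (k < 2 ^ (u + 2))%N]) A_comp u k) `|`
         (\bigcup_(n in [set n | (1 <= n)%N])
            \bigcup_(k in [set k | (k < 2 ^ u)%N]) M_comp u n k)),
      F 0 = 0
    & minimal_decomposition F [set 0] (component_index u) (component u) set0].
Proof.
move=> q m u F.
have [u_gt0 [o oddo qE]] : (1 <= u)%N /\ exists2 o, odd o & q = (2 ^ u * o)%N.
  by have [] := @u1_decomp q isT _; rewrite // /q mulSn; lia.
have disp i : component_index u i ->
    uniform_displacement (component u i) F (index_level u i).
  by move=> iu; rewrite /F /m qE; exact: fib_uniform_displacement.
have F0 : F 0 = 0.
  have even0 k : (fibpoly (2 * k)).[0] = 0 :> Z2.
    elim: k => [|k IH]; first by rewrite muln0 fib0.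
    by rewrite mulnS fibSS IH mul0r add0r.
  by rewrite /F /m (_ : 2 + 12 * q = 2 * (1 + 6 * q))%N ?even0//; ring.
have compE i : component_index u i -> minimal_component F (component u i).
  by move=> /disp; rewrite componentE; exact: disp_minimal_component.
have comp0 i : ~ component u i 0 by move=> /component_val/has_val_neq0.
have cover x : x = 0 \/ exists2 i, component_index u i & component u i x.
  have [->|/eqP x0] := eqVneq x 0; first by left.
  by right; exact: component_cover.
have iter0 n : iter n F 0 = 0 by elim: n => //= n ->.
split=> //.
  apply/seteqP; split=> // x _; have [->|[[k|[n k]] iu ix]] := cover x.
  - by left.
  - by right; left; exists k.
  - by case: iu => n1 kw; right; right; exists n => //; exists k.
split.
- apply/seteqP; split=> // x _; left.
  by have [->|[i iu ix]] := cover x; [left|right; exists i].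
- by apply/seteqP; split=> // x [/= -> [i _ /comp0]].
- by rewrite setI0.
- by rewrite setI0.
- exact: finite_set1.
- apply/seteqP; split=> [_ ->|x [n n0 nx]]; first by exists 1%N.
  have [//|[i iu ix]] := cover x.
  by have := disp_aperiodic (disp i iu) ix n0 nx.
- exact: countableP.
- exact: trivIset_component.
- move=> X; split=> [Xmin|[i iu ->]]; last exact: compE.
  have [X0 [Xopen _] _ _ _] := Xmin.
  have [y Xy y0] := open_has_nonzero Xopen X0.
  have [//|[i iu iy]] := cover y; exists i => //.
  exact: (minimal_component_eq Xmin (compE i iu) Xy iy).
- by [].
Qed.
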